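(* Let $G$ be a group given by one of the following presentations, with all $\gamma_i\ge 2$: (orientable case) $$G=\Big\langle s_1,\dots,s_\ell,a_1,b_1,\dots,a_g,b_g\ \Big|\ s_1^{\gamma_1},\dots,s_\ell^{\gamma_\ell},\ s_1\cdots s_\ell\prod_{i=1}^g[a_i,b_i]\Big\rangle,\quad \ell\ge1,\ g\ge1;$$ (non-orientable case) $$G=\langle s_1,\dots,s_\ell,c_1,\dots,c_h\mid s_1^{\gamma_1},\dots,s_\ell^{\gamma_\ell},\ s_1\cdots s_\ell c_1^2\cdots c_h^2\rangle,$$ with $\ell\ge1,\ h\ge2$, or $\ell\ge2,\ h\ge1$. Let $m$ be the number of indices $i$ with $\gamma_i\ge3$ and $n=\ell-m$ the number of indices $i$ with $\gamma_i=2$. In the orientable case assume that $m\ge5$ if $n$ is even, and $m\ge7$ if $n$ is odd. In the non-orientable case assume that $m\ge5$ if $n+h$ is even, and $m\ge7$ if $n+h$ is odd. Let $j,k\in\{1,\dots,\ell\}$, let $\mathcal U=(s_i^{u_i})_{i\ne j}$ and $\mathcal V=(s_i^{v_i})_{i\neq k}$ be families (indexed by $i\in\{1,\dots,\ell\}\setminus\{j\}$ and $i\in\{1,\dots,\ell\}\setminus\{k\}$ respectively) with integers $u_i,v_i$ satisfying $\gcd(u_i,\gamma_i)=1$ for $i\neq j$ and $\gcd(v_i,\gamma_i)=1$ for $i\ne k$, and define $u_j=v_k=1$. Let $\mathcal U^*=\mathcal U\cup\{a_1,b_1,\dots,a_g,b_g\}$ and $\mathcal V^*=\mathcal V\cup\{a_1,b_1,\dots,a_g,b_g\}$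 in the orientable case, and $\mathcal U^*=\mathcal U\cup\{c_1,\dots,c_h\}$ and $\mathcal V^*=\mathcal V\cup\{c_1,\dots,c_h\}$ in the non-orientable case, considered as families of elements of $G$. Then $\mathcal U^*$ and $\mathcal V^*$ are Nielsen equivalent if and only if $u_i\equiv\pm v_i\pmod{\gamma_i}$ for all $i=1,\dots,\ell$ (where the sign may depend on $i$).
   Context: Nielsen equivalence: for an $N$-tuple $(x_1,\dots,x_N)$ of elements of a group, an elementary Nielsen operation is one of: (1) a permutation of the $x_i$; (2) replacing some $x_i$ by $x_ix_j$ or by $x_jx_i$ with $j\ne i$, leaving the other entries unchanged; (3) replacing some $x_i$ by $x_i^{-1}$, leaving the other entries unchanged. Two tuples are Nielsen equivalent if one is obtained from the other by a finite sequence of elementary Nielsen operations. For families $\mathcal U$ and $\{a_1,\dots\}$, $\mathcal U\cup\{a_1,\dots\}$ means the concatenated family. *)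

(* Defs.v *)
From HB Require Import structures.
From mathcomp Require Import all_boot all_order all_algebra.
From mathcomp Require Import boolp.
From Stdlib Require Import Relation_Operators.

Set Implicit Arguments.
Unset Strict Implicit.
Unset Printing Implicit Defensive.

Local Open Scope group_scope.
Local Open Scope quotient_scope.

(* The letter [(x, false)] stands for [x] and [(x, true)] for its inverse. *)
Notation word X := (seq (X * bool)).

Definition winv (X : Type) (w : word X) : word X :=
  rev [seq (a.1, ~~ a.2) | a <- w].

(* The smallest congruence on words that cancels inverse letters and kills
   the relators in [R]; the quotient is the group <X | R>. *)
Inductive word_eq (X : eqType) (R : seq (word X)) : word X -> word X -> Prop :=
| word_eq_cancel (u v : word X) (x : X) (e : bool) :
    word_eq R (u ++ [:: (x, e); (x, ~~ e)] ++ v) (u ++ v)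
| word_eq_relator (u v r : word X) :
    r \in R -> word_eq R (u ++ r ++ v) (u ++ v)
| word_eq_refl (u : word X) : word_eq R u u
| word_eq_sym (u v : word X) : word_eq R u v -> word_eq R v u
| word_eq_trans (u v w : word X) :
    word_eq R u v -> word_eq R v w -> word_eq R u w.

Definition word_eqb (X : eqType) (R : seq (word X)) : rel (word X) :=
  fun u v => `[< word_eq R u v >].

Lemma word_eqb_refl (X : eqType) (R : seq (word X)) : reflexive (word_eqb R).
Proof. by move=> u; apply/asboolP; exact: word_eq_refl. Qed.

Lemma word_eqb_sym (X : eqType) (R : seq (word X)) : symmetric (word_eqb R).
Proof. by move=> u v; apply/asboolP/asboolP; exact: word_eq_sym. Qed.

Lemma word_eqb_trans (X : eqType) (R : seq (word X)) : transitive (word_eqb R).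
Proof.
by move=> v u w /asboolP uv /asboolP vw; apply/asboolP/(word_eq_trans uv vw).
Qed.

Canonical word_equiv (X : eqType) (R : seq (word X)) : equiv_rel (word X) :=
  EquivRel (word_eqb R) (@word_eqb_refl X R) (@word_eqb_sym X R)
           (@word_eqb_trans X R).

Definition presented (X : choiceType) (R : seq (word X)) : Type :=
  {eq_quot (word_equiv R)}.

HB.instance Definition _ (X : choiceType) (R : seq (word X)) :=
  Choice.on (presented R).

Section PresentedGroup.
Variables (X : choiceType) (R : seq (word X)).
Implicit Types (u v w : word X) (x y z : presented R).

Definition pclass w : presented R := \pi_({eq_quot (word_equiv R)}) w.
Definition prepr x : word X := repr (x : {eq_quot (word_equiv R)}).

Lemma preprK x : pclass (prepr x) = x.
Proof. exact: reprK. Qed.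

Lemma pclassP u v : pclass u = pclass v <-> word_eq R u v.
Proof.
by split=> [/eqmodP/asboolP //|uv]; apply/eqmodP/asboolP.
Qed.

Lemma word_eq_cat u u' v v' :
  word_eq R u u' -> word_eq R v v' -> word_eq R (u ++ v) (u' ++ v').
Proof.
move=> uu' vv'; apply: (@word_eq_trans _ _ _ (u' ++ v)).
  elim: uu' => {u u'} [p q x e|p q r rR|p|p q _|p q r _ IH1 _ IH2].
  - by rewrite -!catA; exact: word_eq_cancel.
  - by rewrite -!catA; exact: word_eq_relator.
  - exact: word_eq_refl.
  - exact: word_eq_sym.
  - exact: word_eq_trans IH1 IH2.
elim: vv' => {v v'} [p q x e|p q r rR|p|p q _|p q r _ IH1 _ IH2].
- by rewrite !(catA u'); exact: word_eq_cancel.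
- by rewrite !(catA u'); exact: word_eq_relator.
- exact: word_eq_refl.
- exact: word_eq_sym.
- exact: word_eq_trans IH1 IH2.
Qed.

Lemma winvK : involutive (@winv X).
Proof.
move=> w; rewrite /winv map_rev revK -map_comp map_id_in // => -[x e] _ /=.
by rewrite negbK.
Qed.

Lemma word_eq_catV w : word_eq R (w ++ winv w) [::].
Proof.
elim: w => [|[x e] w IH]; first exact: word_eq_refl.
rewrite /winv /= rev_cons -/(winv w) -cats1.
have -> : (x, e) :: w ++ winv w ++ [:: (x, ~~ e)] =
  [:: (x, e)] ++ (w ++ winv w) ++ [:: (x, ~~ e)] by rewrite -!catA.
have h := word_eq_cat (word_eq_refl R [:: (x, e)])
            (word_eq_cat IH (word_eq_refl R [:: (x, ~~ e)])).
apply: word_eq_trans h _; exact: (word_eq_cancel R [::] [::]).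
Qed.

Lemma word_eq_catVl w : word_eq R (winv w ++ w) [::].
Proof. by rewrite -{2}[w]winvK; exact: word_eq_catV. Qed.

Definition pone : presented R := pclass [::].
Definition pmul x y : presented R := pclass (prepr x ++ prepr y).
Definition pinv x : presented R := pclass (winv (prepr x)).

Lemma pmulE u v : pmul (pclass u) (pclass v) = pclass (u ++ v).
Proof.
by apply/pclassP/word_eq_cat; apply/pclassP; rewrite preprK.
Qed.

Lemma pmulA : associative pmul.
Proof.
move=> x y z; rewrite -[x]preprK -[y]preprK -[z]preprK.
by rewrite !pmulE catA.
Qed.

Lemma pmul1 : left_id pone pmul.
Proof. by move=> x; rewrite -[x]preprK pmulE. Qed.

Lemma pmul1r : right_id pone pmul.
Proof. by move=> x; rewrite -[x]preprK pmulE cats0. Qed.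

Lemma pmulV : left_inverse pone pinv pmul.
Proof.
by move=> x; rewrite -{2}[x]preprK pmulE; apply/pclassP/word_eq_catVl.
Qed.

Lemma pmulVr : right_inverse pone pinv pmul.
Proof.
by move=> x; rewrite -{1}[x]preprK pmulE; apply/pclassP/word_eq_catV.
Qed.

HB.instance Definition _ := isGroup.Build (presented R)
  pmulA pmul1 pmul1r pmulV pmulVr.

Definition pgen (x : X) : presented R := pclass [:: (x, false)].

End PresentedGroup.

Definition zexpg (G : groupType) (x : G) (z : int) : G :=
  match z with Posz n => x ^+ n | Negz n => x ^- n.+1 end.

(* The [N]-tuples are the sequences of length [N]; every operation preserves
   the length. *)
Inductive nielsen_step (G : groupType) (t : seq G) : seq G -> Prop :=
| nielsen_perm (t' : seq G) : perm_eq t t' -> nielsen_step t t'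
| nielsen_mulr (i j : nat) :
    i < size t -> j < size t -> j != i ->
    nielsen_step t (set_nth 1 t i (nth 1 t i * nth 1 t j))
| nielsen_mull (i j : nat) :
    i < size t -> j < size t -> j != i ->
    nielsen_step t (set_nth 1 t i (nth 1 t j * nth 1 t i))
| nielsen_inv (i : nat) :
    i < size t -> nielsen_step t (set_nth 1 t i ((nth 1 t i)^-1)).

Definition nielsen_equiv (G : groupType) : seq G -> seq G -> Prop :=
  clos_refl_trans (seq G) (@nielsen_step G).

Definition torsion_family (G : groupType) (l : nat) (s : 'I_l -> G)
    (u : 'I_l -> int) (j : 'I_l) : seq G :=
  [seq zexpg (s i) (u i) | i <- enum 'I_l & i != j].

(* Orientable case: the generators are s_i = [inl i], a_i = [inr (inl i)] and
   b_i = [inr (inr i)]; the commutator is [a, b] = a b a^-1 b^-1. *)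
Definition ogen (l g : nat) : choiceType := ('I_l + ('I_g + 'I_g))%type.

Definition orels (l : nat) (gamma : 'I_l -> nat) (g : nat) :
    seq (word (ogen l g)) :=
  rcons [seq nseq (gamma i) (inl i, false) | i <- enum 'I_l]
    ([seq (inl i, false) | i <- enum 'I_l] ++
     flatten [seq [:: (inr (inl i), false); (inr (inr i), false);
                      (inr (inl i), true); (inr (inr i), true)]
             | i <- enum 'I_g]).

Definition ogroup (l : nat) (gamma : 'I_l -> nat) (g : nat) : groupType :=
  presented (orels gamma g).

Definition ofamily (l : nat) (gamma : 'I_l -> nat) (g : nat)
    (u : 'I_l -> int) (j : 'I_l) : seq (ogroup gamma g) :=
  torsion_family (fun i => pgen (orels gamma g) (inl i)) u j ++
  flatten [seq [:: pgen (orels gamma g) (inr (inl i));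
                   pgen (orels gamma g) (inr (inr i))]
          | i <- enum 'I_g].

(* Non-orientable case: s_i = [inl i] and c_i = [inr i]. *)
Definition ngen (l h : nat) : choiceType := ('I_l + 'I_h)%type.

Definition nrels (l : nat) (gamma : 'I_l -> nat) (h : nat) :
    seq (word (ngen l h)) :=
  rcons [seq nseq (gamma i) (inl i, false) | i <- enum 'I_l]
    ([seq (inl i, false) | i <- enum 'I_l] ++
     flatten [seq [:: (inr i, false); (inr i, false)] | i <- enum 'I_h]).

Definition ngroup (l : nat) (gamma : 'I_l -> nat) (h : nat) : groupType :=
  presented (nrels gamma h).

Definition nfamily (l : nat) (gamma : 'I_l -> nat) (h : nat)
    (u : 'I_l -> int) (j : 'I_l) : seq (ngroup gamma h) :=
  torsion_family (fun i => pgen (nrels gamma h) (inl i)) u j ++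
  [seq pgen (nrels gamma h) (inr i) | i <- enum 'I_h].

Definition num_ge3 (l : nat) (gamma : 'I_l -> nat) : nat :=
  #|[set i | 3 <= gamma i]|.

Definition num_eq2 (l : nat) (gamma : 'I_l -> nat) : nat :=
  #|[set i | gamma i == 2]|.

Definition congr_pm (l : nat) (gamma : 'I_l -> nat) (u v : 'I_l -> int) : Prop :=
  forall i : 'I_l, (u i = v i %[mod gamma i])%Z \/
                   (u i = (- v i)%R %[mod gamma i])%Z.

(* Main.v *)
From HB Require Import structures.
Require Import Defs.
From mathcomp Require Import all_boot all_order all_algebra all_fingroup all_field.
From mathcomp Require Import ring.
From Stdlib Require Import Relation_Operators.

(** Multiplying an entry of a tuple by another one, inverting an entry or
    permuting entries changes the Fox Jacobian of the tuple by a matrix that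
    is elementary, monomial in a group element, or a permutation. Under a
    representation [rho] of the group in SL_2 of a field, applied entry by
    entry, the squared determinant of that Jacobian is therefore an invariant
    of Nielsen equivalence, provided that the Jacobian is well defined.
    Instead of working in a quotient of the group ring, the Jacobian is taken
    here to be the matrix of values of a crossed homomorphism [delta] with
    [delta (x y) = delta x + rho x delta y] ([crossed_volume_nielsen]).

    Let [rho] send every further generator [a_i], [b_i] or [c_i] to 1 and [s_i] to a
    matrix [A i] of SL_2 with [A i ^ gamma_i = 1] and without eigenvalue 1, the
    product of the [A i] being 1. Then the values of [delta] on all generators but
    [s_j] may be chosen freely ([fuchsian_crossed_hom_exists]), so that
    these generators have volume 1. Passing to the powers [s_i ^ u_i] multiplies
    the volume by the product of the [det (1 - A i ^ u_i) / det (1 - A i)],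
    and so a Nielsen equivalence forces the product of the
    [det (1 - A i ^ u_i)] to agree with that of the [det (1 - A i ^ v_i)], up to sign
    ([torsion_invariant]).

    The eigenvalues [z_i] and [z_i^-1] of the [A i] may be prescribed
    arbitrarily as soon as three of them are not their own inverses
    ([exists_spectral_product]). With at least four indices such that
    [gamma_i >= 3], one can thus fix any index [i] and let [z_i] run through all
    powers [w ^ k <> 1] of a primitive root of unity [w] of order [gamma_i],
    keeping the other eigenvalues. The result is that
    [|1 - w ^ (k u_i)|] and [|1 - w ^ (k v_i)|] are proportional as functions of [k].
    Both have the same product over [k], because raising to a power prime to
    [gamma_i] permutes the roots of unity. Hence they are equal, and [k = 1] gives
    [u_i = v_i] or [u_i = - v_i] modulo [gamma_i] ([chord_rigidity]).

    Conversely, if [u] and [v] agree up to signs, inversions turn one family into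
    the other when [j = k]. Otherwise [u_k] and [v_j] are [1] or [-1] modulo
    [gamma_k] and [gamma_j]; since the other [s_i] are powers of the
    [s_i ^ u_i], the long relator writes [s_j] as the inverse of [x s_k y]
    with [x] and [y] in the subgroup generated by the common entries, so that
    Nielsen moves replace [s_k] by [s_j] ([powers_swap]). *)

Set Implicit Arguments.
Unset Strict Implicit.
Unset Printing Implicit Defensive.

Import Order.TTheory GRing.Theory Num.Theory.

(** * Nielsen moves *)

Section NielsenMoves.
Local Open Scope group_scope.
Variable G : groupType.
Implicit Types (x y : G) (t : seq G).

Lemma nielsen_equiv_trans t1 t2 t3 :
  nielsen_equiv t1 t2 -> nielsen_equiv t2 t3 -> nielsen_equiv t1 t3.
Proof. exact: rt_trans. Qed.

Lemma nielsen_equiv_perm t t' : perm_eq t t' -> nielsen_equiv t t'.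
Proof. by move=> tt'; apply/rt_step/nielsen_perm. Qed.

Lemma nielsen_equiv_cons x t t' :
  nielsen_equiv t t' -> nielsen_equiv (x :: t) (x :: t').
Proof.
elim=> {t t'} [t t' st|t|t t2 t' _ IH1 _ IH2]; last 1 first.
- exact: nielsen_equiv_trans IH1 IH2.
- apply: rt_step; case: st => [{}t' tt'|a b a_lt b_lt nab|a b a_lt b_lt nab|a a_lt].
  + by apply: nielsen_perm; rewrite perm_cons.
  + exact: (@nielsen_mulr _ (x :: t) a.+1 b.+1).
  + exact: (@nielsen_mull _ (x :: t) a.+1 b.+1).
  + exact: (@nielsen_inv _ (x :: t) a.+1).
- exact: rt_refl.
Qed.

Lemma nielsen_inv_head x t : nielsen_equiv (x :: t) (x^-1 :: t).
Proof. by apply: rt_step; apply: (@nielsen_inv _ (x :: t) 0). Qed.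

(** The elements by which the head of [x :: t] may be multiplied, on either
    side, without leaving its Nielsen class. They include the subgroup generated
    by [t], and this is how relations of the group are fed into Nielsen moves. *)
Definition absorbs t y := forall x,
  nielsen_equiv (x :: t) (x * y :: t) /\ nielsen_equiv (x :: t) (y * x :: t).

Lemma absorbs1 t : absorbs t 1.
Proof. by move=> x; rewrite mulg1 mul1g; split; apply: rt_refl. Qed.

Lemma absorbs_mem t y : y \in t -> absorbs t y.
Proof.
move=> yt x; have lt : index y t < size t by rewrite index_mem.
split; apply: rt_step.
- rewrite -{1}(nth_index 1 yt).
  exact: (@nielsen_mulr _ (x :: t) 0 (index y t).+1).
- rewrite -{1}(nth_index 1 yt).
  exact: (@nielsen_mull _ (x :: t) 0 (index y t).+1).
Qed.

Lemma absorbsM t y z : absorbs t y -> absorbs t z -> absorbs t (y * z).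
Proof.
move=> hy hz x; split.
- rewrite mulgA; exact: nielsen_equiv_trans (proj1 (hy x)) (proj1 (hz _)).
- rewrite -mulgA; exact: nielsen_equiv_trans (proj2 (hz x)) (proj2 (hy _)).
Qed.

(** Division on one side is multiplication on the other side of the inverse. *)
Lemma absorbsV t y : absorbs t y -> absorbs t y^-1.
Proof.
move=> hy x; split.
- rewrite -[x * _]invgK invgM invgK.
  apply: nielsen_equiv_trans (nielsen_inv_head _ _) _.
  exact: nielsen_equiv_trans (proj2 (hy _)) (nielsen_inv_head _ _).
- rewrite -[_ * x]invgK invgM invgK.
  apply: nielsen_equiv_trans (nielsen_inv_head _ _) _.
  exact: nielsen_equiv_trans (proj1 (hy _)) (nielsen_inv_head _ _).
Qed.

Lemma absorbsX t y n : absorbs t y -> absorbs t (y ^+ n).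
Proof.
move=> hy; elim: n => [|n IH]; first exact: absorbs1.
by rewrite expgS; apply: absorbsM.
Qed.

Lemma absorbs_prod t (s : seq G) :
  (forall y, y \in s -> absorbs t y) -> absorbs t (\prod_(y <- s) y).
Proof.
elim: s => [|y s IH] hs; first by rewrite big_nil; apply: absorbs1.
rewrite big_cons; apply: absorbsM; first by apply: hs; rewrite mem_head.
by apply: IH => z zs; apply: hs; rewrite inE zs orbT.
Qed.

Lemma nielsen_head_mulV t (a b x : G) :
  absorbs t a -> absorbs t b -> nielsen_equiv (x :: t) ((a * x * b)^-1 :: t).
Proof.
move=> ha hb; apply: nielsen_equiv_trans (proj2 (ha x)) _.
apply: nielsen_equiv_trans (proj1 (hb _)) _; exact: nielsen_inv_head.
Qed.

Lemma nielsen_map_pm (L : eqType) (f f' : L -> G) (s : seq L) :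
  {in s, forall c, f' c = f c \/ f' c = (f c)^-1} ->
  nielsen_equiv (map f s) (map f' s).
Proof.
elim: s => [|c s IH] ff' /=; first exact: rt_refl.
apply: (@nielsen_equiv_trans _ (f' c :: map f s)).
  case: (ff' c (mem_head _ _)) => ->; first exact: rt_refl.
  exact: nielsen_inv_head.
by apply/nielsen_equiv_cons/IH => d ds; apply: ff'; rewrite inE ds orbT.
Qed.

End NielsenMoves.

(** * Presented groups *)

Section PresentedWords.
Local Open Scope group_scope.
Variables (X : choiceType) (R : seq (word X)).

(** Fixing the group structure once and for all keeps a single canonical path
    to the operations of the presented group. *)
Definition pgroup : groupType := presented R.
Definition word_class (w : word X) : pgroup := pclass R w.
Definition gen (x : X) : pgroup := pgen R x.

Lemma word_class_cat u v : word_class (u ++ v) = word_class u * word_class v.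
Proof. exact/esym/pmulE. Qed.

Lemma word_class_inv x : word_class [:: (x, true)] = (gen x)^-1.
Proof.
apply/esym/mulg1_eq; rewrite -[gen x]/(word_class [:: (x, false)]) -word_class_cat.
apply/pclassP; exact: (@word_eq_cancel _ R [::] [::] x false).
Qed.

Lemma word_class_prod w :
  word_class w = \prod_(a <- w) (if a.2 then (gen a.1)^-1 else gen a.1).
Proof.
elim: w => [|[x e] w IH]; first by rewrite big_nil.
rewrite big_cons -IH /= -cat1s word_class_cat; congr (_ * _).
by case: e => //; rewrite word_class_inv.
Qed.

Lemma word_class_relator r : r \in R -> word_class r = 1.
Proof.
move=> rR; apply/pclassP.
by rewrite -[r]cats0; apply: (@word_eq_relator _ _ [::] [::]).
Qed.

End PresentedWords.

Section PresentedMorphism.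
Variables (X : choiceType) (R : seq (word X)) (T : Type) (one : T).
Variables (mul : Monoid.law one) (f : X * bool -> T).
Hypothesis fV : forall x e, mul (f (x, e)) (f (x, ~~ e)) = one.
Hypothesis fR : forall r, r \in R -> \big[mul/one]_(a <- r) f a = one.

Lemma word_eq_eval u v : word_eq R u v ->
  \big[mul/one]_(a <- u) f a = \big[mul/one]_(a <- v) f a.
Proof.
elim=> {u v} [u v x e|u v r rR|u|u v _ ->|u v w _ -> _ ->] //.
- by rewrite !big_cat !big_cons big_nil /= Monoid.mulm1 fV Monoid.mul1m.
- by rewrite !big_cat /= (fR rR) Monoid.mul1m.
Qed.

Definition presented_eval (x : pgroup R) : T :=
  \big[mul/one]_(a <- prepr x) f a.

Lemma presented_eval_class w :
  presented_eval (word_class R w) = \big[mul/one]_(a <- w) f a.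
Proof. by apply: word_eq_eval; apply/pclassP; rewrite preprK. Qed.

Lemma presented_evalM x y :
  presented_eval (x * y : pgroup R)%g = mul (presented_eval x) (presented_eval y).
Proof. by rewrite presented_eval_class big_cat. Qed.

Lemma presented_eval_gen x : presented_eval (gen R x) = f (x, false).
Proof. by rewrite presented_eval_class big_seq1. Qed.

End PresentedMorphism.


(** * The volume of a tuple under a crossed homomorphism *)

Lemma det_1D_mulmxC (K : comNzRingType) m n (A : 'M[K]_(m, n)) (B : 'M[K]_(n, m)) :
  (\det (1%:M + A *m B) = \det (1%:M + B *m A))%R.
Proof.
have e1 : (block_mx 1%:M (- A) B 1%:M =
    block_mx 1%:M 0 B 1%:M *m block_mx 1%:M (- A) 0 (1%:M + B *m A))%R.
  by rewrite mulmx_block !mul1mx !mulmx1 !mul0mx !addr0 mulmxN addrCA addNr addr0.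
have e2 : (block_mx 1%:M (- A) B 1%:M =
    block_mx (1%:M + A *m B) (- A) 0 1%:M *m block_mx 1%:M 0 B 1%:M)%R.
  by rewrite mulmx_block !mulmx1 !mul1mx !mulmx0 !add0r mulNmx addrK.
have := congr1 determinant e1; rewrite {1}e2 !det_mulmx !det_ublock !det_lblock.
by rewrite !det1 !mulr1 !mul1r.
Qed.

Section BlockCoordinates.
Local Open Scope ring_scope.
Variables (K : comNzRingType) (N : nat).
Implicit Types (i j : 'I_N).

Definition block_proj i : 'M[K]_(2, N * 2) :=
  \matrix_(a, r) (r == mxvec_index i a)%:R.

Definition block_inj i : 'M[K]_(N * 2, 2) := (block_proj i)^T.

Lemma block_projK i j :
  block_proj i *m block_inj j = if i == j then 1%:M else 0.
Proof.
apply/matrixP=> a b; rewrite !mxE.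
rewrite (bigD1 (mxvec_index i a)) //= big1 ?addr0; last first.
  by move=> r /negPf r_ne; rewrite !mxE r_ne mul0r.
rewrite !mxE eqxx mul1r.
have -> : (mxvec_index i a == mxvec_index j b) = ((i, a) == (j, b)).
  by rewrite /mxvec_index (inj_eq (@cast_ord_inj _ _ _)) (inj_eq enum_rank_inj).
by rewrite xpair_eqE; case: (i == j); rewrite mxE.
Qed.

Lemma block_sum1 : \sum_i block_inj i *m block_proj i = 1%:M.
Proof.
apply/matrixP=> r c; rewrite summxE; case/mxvec_indexP: r => i a.
rewrite (bigD1 i) //= big1 ?addr0; last first.
  move=> j ji; rewrite mxE big1 // => b _; rewrite !mxE.
  rewrite /mxvec_index (inj_eq (@cast_ord_inj _ _ _)) (inj_eq enum_rank_inj).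
  by rewrite xpair_eqE eq_sym (negPf ji) mul0r.
rewrite mxE (bigD1 a) //= big1 ?addr0; last first.
  move=> b ba; rewrite !mxE.
  rewrite /mxvec_index (inj_eq (@cast_ord_inj _ _ _)) (inj_eq enum_rank_inj).
  by rewrite xpair_eqE eqxx eq_sym (negPf ba) mul0r.
by rewrite !mxE eqxx mul1r eq_sym.
Qed.

Lemma block_proj_sum (F : 'I_N -> 'M[K]_(2, N * 2)) i :
  block_proj i *m (\sum_j block_inj j *m F j) = F i.
Proof.
rewrite mulmx_sumr (bigD1 i) //= big1 ?addr0 => [|j ji]; rewrite mulmxA block_projK.
  by rewrite eqxx mul1mx.
by rewrite eq_sym (negPf ji) mul0mx.
Qed.

(** Overwriting the [i]-th block of rows of [E] by [C *m E] is left
    multiplication by a matrix which is the identity outside that block. *)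
Lemma det_replace_block (E : 'M[K]_(N * 2)) (C : 'M[K]_(2, N * 2)) i :
  \det (E + block_inj i *m (C *m E - block_proj i *m E)) =
  \det (C *m block_inj i) * \det E.
Proof.
rewrite -mulmxBl mulmxA -{1}[E]mul1mx -mulmxDl det_mulmx det_1D_mulmxC.
by rewrite mulmxBl block_projK eqxx addrC subrK.
Qed.

Lemma det_block_diag (C : 'I_N -> 'M[K]_2) :
  \det (\sum_i block_inj i *m (C i *m block_proj i)) = \prod_i \det (C i).
Proof.
pose D (s : seq 'I_N) : 'M[K]_(N * 2) :=
  \sum_i block_inj i *m ((if i \in s then C i else 1%:M) *m block_proj i).
suff detD s : uniq s -> \det (D s) = \prod_(i <- s) \det (C i).
  rewrite -(detD _ (index_enum_uniq _)); congr (\det _).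
  by apply: eq_bigr => i _; rewrite mem_index_enum.
elim: s => [|i s IH] /=.
  rewrite big_nil -[RHS](@det1 K (N * 2)) -block_sum1 => _; congr (\det _).
  by apply: eq_bigr => i _; rewrite in_nil mul1mx.
case/andP=> i_s /IH {}IH; rewrite big_cons -IH.
have iD : block_proj i *m D s = block_proj i.
  by rewrite block_proj_sum (negPf i_s) mul1mx.
rewrite -[X in \det X](_ : D s + block_inj i *m
    ((C i *m block_proj i) *m D s - block_proj i *m D s) = _); last first.
  rewrite -mulmxA iD /D (bigD1 i) //= [RHS](bigD1 i) //= (negPf i_s) mul1mx.
  rewrite mem_head mulmxBr addrAC addrCA subrr addr0; congr (_ + _).
  by apply: eq_bigr => j ji; rewrite inE (negPf ji).
by rewrite det_replace_block -mulmxA block_projK eqxx mulmx1.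
Qed.

End BlockCoordinates.

Section CrossedVolume.
Local Open Scope ring_scope.
Variables (K : comNzRingType) (N : nat) (G : groupType).
Variables (rho : G -> 'M[K]_2) (delta : G -> 'M[K]_(2, N * 2)).
Hypothesis rho_det : forall x, \det (rho x) = 1.
Hypothesis deltaM : forall x y : G, delta (x * y)%g = delta x + rho x *m delta y.
Hypothesis rho1 : rho 1%g = 1%:M.

Definition crossed_mx (t : seq G) : 'M[K]_(N * 2) :=
  \sum_(i < N) block_inj K i *m delta (nth 1%g t i).

Lemma block_proj_crossed t (i : 'I_N) :
  block_proj K i *m crossed_mx t = delta (nth 1%g t i).
Proof. exact: block_proj_sum. Qed.

Lemma crossed_mx_set_nth t (i : 'I_N) x : size t = N ->
  crossed_mx (set_nth 1%g t i x) =
  crossed_mx t + block_inj K i *m (delta x - delta (nth 1%g t i)).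
Proof.
move=> tN; rewrite /crossed_mx (bigD1 i) //= [X in _ = X + _](bigD1 i) //=.
rewrite nth_set_nth /= eqxx mulmxBr addrAC addrCA subrr addr0; congr (_ + _).
by apply: eq_bigr => j ji; rewrite nth_set_nth /= val_eqE (negPf ji).
Qed.

Lemma delta1 : delta 1%g = 0.
Proof.
have /eqP := deltaM 1%g 1%g.
by rewrite mulg1 rho1 mul1mx -subr_eq0 opprD addrA subrr sub0r oppr_eq0 => /eqP.
Qed.

Lemma deltaV x : delta x^-1%g = - rho x^-1%g *m delta x.
Proof.
apply/eqP; rewrite mulNmx -addr_eq0 -deltaM mulVg; apply/eqP; exact: delta1.
Qed.

Lemma crossed_volume_perm t t' : size t = N -> perm_eq t t' ->
  \det (crossed_mx t') ^+ 2 = \det (crossed_mx t) ^+ 2.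
Proof.
move=> tN; rewrite perm_sym => tt'.
have [s def_t'] : exists s : 'S_N, forall i : 'I_N, nth 1%g t' i = nth 1%g t (s i).
  have /eqP tN' := tN; have /tuple_permP[s def_t'] : perm_eq t' (Tuple tN') by [].
  exists s => i; rewrite def_t' -(tnth_nth 1%g [tuple _ | i < N]) tnth_mktuple.
  by rewrite (tnth_nth 1%g).
pose S : 'M[K]_(N * 2) := \sum_i block_inj K i *m block_proj K (s i).
have SE i : block_proj K i *m S = block_proj K (s i) by rewrite block_proj_sum.
have -> : crossed_mx t' = S *m crossed_mx t.
  rewrite /crossed_mx mulmx_suml; apply: eq_bigr => i _.
  by rewrite -mulmxA block_proj_crossed def_t'.
have ST : S^T = \sum_j block_inj K j *m block_proj K ((s^-1)%g j).
  rewrite /S raddf_sum (reindex_inj (@perm_inj _ (s^-1)%g)); apply: eq_bigr => j _.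
  by rewrite /= trmx_mul trmxK permKV.
have SST : S *m S^T = 1%:M.
  rewrite -block_sum1 {1}/S mulmx_suml; apply: eq_bigr => i _.
  by rewrite -mulmxA ST block_proj_sum permK.
have /eqP := congr1 determinant SST.
rewrite det_mulmx det_tr det1 -expr2 => /eqP S1.
by rewrite det_mulmx exprMn S1 mul1r.
Qed.

(** Multiplying or inverting an entry acts on [crossed_mx] by a matrix whose
    determinant is that of some [rho x] or [- rho x], hence 1 because the
    blocks have even size; a permutation of the entries contributes a sign,
    which the square forgets. *)
Lemma crossed_volume_step t t' : size t = N -> nielsen_step t t' ->
  size t' = N /\ \det (crossed_mx t') ^+ 2 = \det (crossed_mx t) ^+ 2.
Proof.
move=> tN st.
have replace (x : G) (i : nat) (C : 'M[K]_(2, N * 2)) (i_lt : (i < size t)%N) :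
    delta x = C *m crossed_mx t ->
    (forall j : 'I_N, j = i :> nat -> \det (C *m block_inj K j) = 1) ->
    size (set_nth 1%g t i x) = N /\
    \det (crossed_mx (set_nth 1%g t i x)) ^+ 2 = \det (crossed_mx t) ^+ 2.
  move=> xC detC; split; first by rewrite size_set_nth tN; apply/maxn_idPr; rewrite -tN.
  have i_ltN : (i < N)%N by rewrite -tN.
  rewrite (crossed_mx_set_nth (Ordinal i_ltN) x tN) xC -block_proj_crossed.
  by rewrite det_replace_block detC // mul1r.
case: st => [{}t' tt'|a b a_lt b_lt ba|a b a_lt b_lt ba|a a_lt].
- by split; [rewrite -(perm_size tt') | apply: crossed_volume_perm].
- have [a_ltN b_ltN] : (a < N)%N /\ (b < N)%N by rewrite -tN.
  apply: (replace _ _ (block_proj K (Ordinal a_ltN) +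
            rho (nth 1%g t a) *m block_proj K (Ordinal b_ltN))) => // [|c ca].
    by rewrite mulmxDl -mulmxA !block_proj_crossed deltaM.
  rewrite mulmxDl -mulmxA !block_projK -!val_eqE /= ca eqxx (negPf ba) mulmx0 addr0.
  exact: det1.
- have [a_ltN b_ltN] : (a < N)%N /\ (b < N)%N by rewrite -tN.
  apply: (replace _ _ (block_proj K (Ordinal b_ltN) +
            rho (nth 1%g t b) *m block_proj K (Ordinal a_ltN))) => // [|c ca].
    by rewrite mulmxDl -mulmxA !block_proj_crossed deltaM.
  rewrite mulmxDl -mulmxA !block_projK -!val_eqE /= ca eqxx (negPf ba) mulmx1 add0r.
  exact: rho_det.
- have a_ltN : (a < N)%N by rewrite -tN.
  apply: (replace _ _ (- rho (nth 1%g t a)^-1%g *m block_proj K (Ordinal a_ltN)))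
    => // [|c ca].
    by rewrite -mulmxA block_proj_crossed deltaV.
  rewrite -mulmxA block_projK -val_eqE /= ca eqxx mulmx1 -scaleN1r detZ rho_det.
  by rewrite mulr1 sqrrN expr1n.
Qed.

Lemma crossed_volume_nielsen t t' : size t = N -> nielsen_equiv t t' ->
  \det (crossed_mx t') ^+ 2 = \det (crossed_mx t) ^+ 2.
Proof.
move=> tN tt'.
suff: size t = N -> size t' = N /\
  \det (crossed_mx t') ^+ 2 = \det (crossed_mx t) ^+ 2 by case/(_ tN).
elim: tt' => {tN t t'} [t t' st tN|t|t t1 t' _ IH1 _ IH2 tN] //.
  exact: crossed_volume_step.
by have [/IH2[t'N ->] ->] := IH1 tN.
Qed.

(** Entrywise left multiplication by 2 x 2 matrices is block-diagonal. *)
Lemma crossed_volume_scale (L : Type) (x0 : L) (s : seq L) (f f' : L -> G)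
    (C : L -> 'M[K]_2) :
  size s = N -> (forall c, delta (f' c) = C c *m delta (f c)) ->
  \det (crossed_mx (map f' s)) =
  (\prod_(c <- s) \det (C c)) * \det (crossed_mx (map f s)).
Proof.
move=> sN ff'.
rewrite (big_nth x0) sN big_mkord -det_block_diag -det_mulmx; congr (\det _).
rewrite mulmx_suml; apply: eq_bigr => i _; rewrite -!mulmxA block_proj_crossed.
by rewrite !(nth_map x0) ?sN ?ff'.
Qed.

End CrossedVolume.

(** * Representations with prescribed eigenvalues *)

Section TwoByTwo.
Local Open Scope ring_scope.
Variable K : fieldType.
Implicit Types (A B : 'M[K]_2) (z : K).

Definition mx2 (a b c d : K) : 'M[K]_2 :=
  \matrix_(i, j) if i == 0 then (if j == 0 then a else b)
                 else (if j == 0 then c else d).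

Lemma mx2_eta A : A = mx2 (A 0 0) (A 0 1) (A 1 0) (A 1 1).
Proof.
have I2 (x : 'I_2) : x = 0 \/ x = 1.
  by case: x => [[|[|//]] x_lt]; [left | right]; apply: val_inj.
by apply/matrixP=> i j; rewrite mxE; case: (I2 i) => ->; case: (I2 j) => ->.
Qed.

Lemma mulmx2 a b c d a' b' c' d' : mx2 a b c d * mx2 a' b' c' d' =
  mx2 (a * a' + b * c') (a * b' + b * d') (c * a' + d * c') (c * b' + d * d').
Proof.
by rewrite [LHS]mx2_eta; congr mx2; rewrite !mxE !big_ord_recl big_ord0 !mxE addr0.
Qed.

Lemma det_mx2 a b c d : \det (mx2 a b c d) = a * d - b * c.
Proof.
rewrite (expand_det_row _ 0) !big_ord_recl big_ord0 /cofactor !det_mx11 !mxE /=.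
by rewrite addr0 !expr0 mul1r expr1 mulN1r mulrN.
Qed.

Lemma trace_mx2 a b c d : \tr (mx2 a b c d) = a + d.
Proof. by rewrite /mxtrace !big_ord_recl big_ord0 !mxE addr0. Qed.

Lemma mx2_1 : 1 = mx2 1 0 0 1.
Proof. by rewrite [LHS]mx2_eta; congr mx2; rewrite mxE. Qed.

Lemma det_1B_mx2 A : \det (1 - A) = 1 - \tr A + \det A.
Proof.
rewrite (mx2_eta (1 - A)) [in RHS](mx2_eta A) !det_mx2 trace_mx2 !mxE /=; ring.
Qed.

Lemma sqr_mx2 A : A * A = \tr A *: A - (\det A)%:M.
Proof.
rewrite (mx2_eta A) det_mx2 trace_mx2 mulmx2 [RHS]mx2_eta.
by congr mx2; rewrite !mxE /=; ring.
Qed.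

(** Membership in SL_2 with eigenvalues [z] and [z^-1], read off the
    characteristic polynomial so that [A] need not be diagonalizable. *)
Definition spectral A z := \det A = 1 /\ \tr A = z + z^-1.

Lemma spectral_det1 A z n : spectral A z -> \det (A ^+ n) = 1.
Proof.
case=> dA _; elim: n => [|n IH]; first by rewrite expr0 det1.
by rewrite exprS -mulmxE det_mulmx dA IH mul1r.
Qed.

Lemma spectral_exprSS A z n : spectral A z ->
  A ^+ n.+2 = (z + z^-1) *: A ^+ n.+1 - A ^+ n.
Proof.
case=> dA tA; rewrite !exprS mulrA sqr_mx2 dA tA mulrBl -scalerAl.
by rewrite -mulmxE mul_scalar_mx scale1r.
Qed.

Lemma spectral_trX A z n : z != 0 -> spectral A z ->
  \tr (A ^+ n) = z ^+ n + z ^- n.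
Proof.
move=> z0 zA.
suff [] : \tr (A ^+ n) = z ^+ n + z ^- n /\
          \tr (A ^+ n.+1) = z ^+ n.+1 + z ^- n.+1 by [].
elim: n => [|n [IH1 IH2]].
  by rewrite expr0 mxtrace1 !expr1 expr0 invr1; case: zA.
split=> //; rewrite (spectral_exprSS _ zA) raddfB /= mxtraceZ IH1 IH2.
by rewrite -!exprVn !exprS; field.
Qed.

Lemma spectral_det1BX A z n : z != 0 -> spectral A z ->
  \det (1 - A ^+ n) = (1 - z ^+ n) * (1 - z ^- n).
Proof.
move=> z0 zA; rewrite det_1B_mx2 (spectral_trX n z0 zA) (spectral_det1 n zA).
have zn0 : z ^+ n != 0 by rewrite expf_neq0.
by field.
Qed.

(** When the two eigenvalues are distinct [A] is diagonalizable, so it has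
    the same order as [z]. *)
Lemma spectral_expr1 A z n : z != 0 -> z ^+ 2 != 1 -> spectral A z ->
  z ^+ n = 1 -> A ^+ n = 1.
Proof.
move=> z0 z2 zA zn1.
have zz0 : z - z^-1 != 0.
  apply: contra_neq z2 => /eqP; rewrite subr_eq0 => /eqP zz.
  by rewrite expr2 {1}zz mulVf.
have powA m : (z - z^-1) *: A ^+ m.+1 =
    (z ^+ m.+1 - z ^- m.+1) *: A - ((z ^+ m - z ^- m) *: 1).
  suff [] : (z - z^-1) *: A ^+ m.+1 =
    (z ^+ m.+1 - z ^- m.+1) *: A - ((z ^+ m - z ^- m) *: 1) /\
    (z - z^-1) *: A ^+ m.+2 =
    (z ^+ m.+2 - z ^- m.+2) *: A - ((z ^+ m.+1 - z ^- m.+1) *: 1) by [].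
  elim: m => [|m [IH1 IH2]].
    rewrite !expr1 !expr0 invr1 subrr scale0r subr0; split=> //.
    rewrite (spectral_exprSS _ zA) expr1 expr0 scalerBr scalerA; congr (_ *: _ - _).
    by rewrite -exprVn !expr2; ring.
  split=> //; rewrite (spectral_exprSS _ zA) scalerBr scalerA.
  rewrite [_ * (z + _)]mulrC -scalerA IH1 IH2 !scalerBr !scalerA.
  have BB (a b c d : K) (B : 'M[K]_2) :
      a *: A - b *: B - (c *: A - d *: B) = (a - c) *: A - (b - d) *: B.
    by rewrite !scalerBl !opprB addrACA [RHS]addrACA [- (b *: _) + _]addrC.
  by rewrite BB; congr (_ *: _ - _ *: _); rewrite -!exprVn !exprS; field.
case: n zn1 => [|n] zn1; first by rewrite expr0.
apply: (scalerI zz0); rewrite powA zn1 invr1 subrr scale0r sub0r -scaleNr opprB.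
have -> : z ^+ n = z^-1 by apply: (mulfI z0); rewrite -exprS zn1 divff.
by rewrite invrK.
Qed.

Lemma trace_inv_mx2 A : \det A = 1 -> \tr A^-1 = \tr A.
Proof.
move=> dA; have AU : A \is a GRing.unit by rewrite unitmxE dA unitr1.
have -> : A^-1 = (\tr A)%:M - A.
  apply: (mulrI AU); rewrite mulrV // mulrBr sqr_mx2 dA.
  by rewrite -mulmxE mul_mx_scalar opprB addrC subrK.
by rewrite raddfB /= mxtrace_scalar mulr2n addrK.
Qed.

(** Any sequence of eigenvalue pairs is realized by matrices of SL_2 with
    product 1 as soon as the matrices at three entries [p], [q], [r] need not
    be diagonal. All other matrices are diagonal;
    the upper triangular entry at [r] makes the product of all entries but
    those at [p] and [q] a non-scalar upper triangular matrix [W], so that a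
    lower triangular entry at [p] can give [A p * W] any prescribed trace;
    the entry at [q] is then the inverse of the rest of the product. *)
Lemma exists_spectral_product (L : eqType) (s : seq L) (z : L -> K) (p q r : L) :
  uniq s -> p \in s -> q \in s -> r \in s -> p != q -> p != r -> q != r ->
  (forall c, z c != 0) ->
  exists A : L -> 'M[K]_2,
    [/\ forall c, spectral (A c) (z c),
       forall c, c \notin [:: p; q; r] -> A c = mx2 (z c) 0 0 (z c)^-1 &
       \prod_(c <- s) A c = 1].
Proof.
move=> s_uniq ps qs rs pq pr qr z0.
wlog [s1 [s2 [s3 def_s]]] : p q ps qs pq pr qr /
    exists s1 s2 s3, s = s1 ++ p :: s2 ++ q :: s3.
  have split2 (c : L) t : c \in t -> exists t1 t2, t = t1 ++ c :: t2.
    by case/splitPr=> t1 t2; exists t1, t2.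
  move=> IH; have [s1 [s2 def_s]] := split2 _ _ ps.
  have: q \in s1 ++ p :: s2 by rewrite -def_s.
  rewrite mem_cat inE [q == p]eq_sym (negPf pq).
  case/orP=> /split2[t1 [t2 def_t]].
    have [||A [spA diagA prodA]] := IH q p qs ps _ qr pr; first by rewrite eq_sym.
      by exists t1, t2, s2; rewrite def_s def_t -catA.
    by exists A; split=> // c c_pqr; apply: diagA; move: c_pqr; rewrite !inE orbCA.
  by apply: (IH p q) => //; exists s1, t1, t2; rewrite def_s def_t.
pose A0 c := mx2 (z c) (c == r)%:R 0 (z c)^-1.
have A0_prod t : exists w x : K,
    [/\ w != 0, \prod_(c <- t) A0 c = mx2 w x 0 w^-1,
       r \notin t -> x = 0 & uniq t -> r \in t -> x != 0].
  elim: t => [|c t [w [x [w0 tE xr xNr]]]].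
    exists 1, 0; split=> //; first exact: oner_neq0.
    by rewrite big_nil invr1 mx2_1.
  exists (z c * w), (z c * x + (c == r)%:R * w^-1); split.
  - by rewrite mulf_neq0.
  - by rewrite big_cons tE mulmx2; congr mx2; rewrite ?mulr0 ?mul0r ?addr0 ?add0r ?invfM.
  - by rewrite inE negb_or eq_sym => /andP[/negPf-> /xr->]; rewrite mulr0 mul0r addr0.
  - rewrite /= inE [r == c]eq_sym => /andP[c_t t_uniq].
    case: eqP => [cr _|_ /= r_t]; last by rewrite mul0r addr0 mulf_neq0 ?xNr.
    by rewrite xr -?cr // mulr0 add0r mul1r invr_neq0.
pose W := \prod_(c <- s2 ++ s3 ++ s1) A0 c.
have [w [x [w0 WE _ x_neq0]]] := A0_prod (s2 ++ s3 ++ s1).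
have s_perm : perm_eq s (p :: q :: s2 ++ s3 ++ s1).
  by apply/seq.permP=> a; rewrite def_s /= !count_cat /= count_cat /=; ring.
have s_uniq' : uniq (p :: q :: s2 ++ s3 ++ s1) by rewrite -(perm_uniq s_perm).
have x0 : x != 0.
  apply: x_neq0.
    by case/and3P: s_uniq'.
  move: rs; rewrite (perm_mem s_perm) !inE ![r == _]eq_sym.
  by rewrite (negPf pr) (negPf qr).
(* The solution of [\tr (A p * W) = z q + (z q)^-1], which is linear in [y]. *)
pose y := (z q + (z q)^-1 - z p * w - (z p)^-1 * w^-1) / x.
pose Ap := mx2 (z p) 0 y (z p)^-1.
pose B := \prod_(c <- s1) A0 c * Ap * \prod_(c <- s2) A0 c.
pose C := \prod_(c <- s3) A0 c.
have detA0 t : \det (\prod_(c <- t) A0 c) = 1.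
  have [w' [x' [w'0 -> _ _]]] := A0_prod t.
  by rewrite det_mx2 divff // mulr0 subr0.
have detAp : \det Ap = 1 by rewrite det_mx2 divff // mul0r subr0.
have detB : \det B = 1 by rewrite /B -!mulmxE !det_mulmx !detA0 detAp !mulr1.
have unitB : B \is a GRing.unit by rewrite unitmxE detB unitr1.
have unitC : C \is a GRing.unit by rewrite unitmxE detA0 unitr1.
have detCB : \det (C * B) = 1 by rewrite -mulmxE det_mulmx detB detA0 mulr1.
pose A c := if c == p then Ap else if c == q then (C * B)^-1 else A0 c.
have A_A0 t : p \notin t -> q \notin t -> \prod_(c <- t) A c = \prod_(c <- t) A0 c.
  move=> p_t q_t; apply: eq_big_seq => c c_t; rewrite /A.
  by rewrite (negPf (memPn p_t _ c_t)) (negPf (memPn q_t _ c_t)).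
exists A; split=> [c|c|].
- rewrite /A; case: (eqVneq c p) => [->|_].
    by split=> //; rewrite trace_mx2.
  case: (eqVneq c q) => [->|_]; last first.
    by rewrite /spectral det_mx2 trace_mx2 divff // mulr0 subr0.
  split; first by rewrite det_inv detCB invr1.
  rewrite trace_inv_mx2 // /B -!mulrA mulrA -mulmxE mxtrace_mulC mulmxE.
  have -> : Ap * \prod_(c <- s2) A0 c * (C * \prod_(c <- s1) A0 c) = Ap * W.
    by rewrite /W !big_cat -mulrA.
  rewrite /W WE mulmx2 trace_mx2 mul0r addr0 /y divfK //; ring.
- rewrite !inE !negb_or /A => /and3P[/negPf-> /negPf-> /negPf cr].
  by rewrite /A0 cr.
- move: s_uniq' => /= /andP[]; rewrite inE negb_or => /andP[_ p_s] /andP[q_s _].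
  move: p_s q_s; rewrite !mem_cat !negb_or => /and3P[p2 p3 p1] /and3P[q2 q3 q1].
  rewrite def_s big_cat big_cons big_cat big_cons /= !A_A0 // {1 2}/A !eqxx.
  rewrite [q == p]eq_sym (negPf pq) -/C invrM // !mulrA -/B mulrV // mul1r.
  by rewrite mulVr.
Qed.

End TwoByTwo.

(** * The families in a common form *)

(** Both presentations have generators [inl i] of finite order together with
    some further generators [inr y], and a long relator whose part [tail]
    after the product of the [inl i] involves the latter only. *)
Section Families.
Local Open Scope group_scope.
Variables (l : nat) (gamma : 'I_l -> nat) (Y : choiceType).
Variables (tail : word ('I_l + Y)%type) (ys : seq Y).

Definition fuchsian_rels : seq (word ('I_l + Y)%type) :=
  rcons [seq nseq (gamma i) (inl i, false) | i <- enum 'I_l]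
    ([seq (inl i, false) | i <- enum 'I_l] ++ tail).

Definition labels (P : pred 'I_l) : seq ('I_l + Y) :=
  [seq inl i | i <- enum 'I_l & P i] ++ [seq inr y | y <- ys].

Local Notation G := (pgroup fuchsian_rels).
Local Notation gen := (gen fuchsian_rels).

Definition powers (e : 'I_l -> nat) (c : 'I_l + Y) : G :=
  if c is inl i then gen c ^+ e i else gen c.

Hypothesis gamma_ge2 : forall i, 2 <= gamma i.
Hypothesis tail_ys : forall a, a \in tail -> exists2 y, y \in ys & a.1 = inr y.
Hypothesis ys_uniq : uniq ys.

Lemma mem_labels_inl P i : (inl i \in labels P) = P i.
Proof.
rewrite mem_cat orbC; case: mapP => [[y _ []]|_] //=.
by rewrite mem_map 1?mem_filter ?mem_enum ?andbT // => ? ? [].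
Qed.

Lemma mem_labels_inr P y : (inr y \in labels P) = (y \in ys).
Proof.
rewrite mem_cat; case: mapP => [[i _ []]|_] //=.
by rewrite mem_map // => ? ? [].
Qed.

Lemma labels_uniq P : uniq (labels P).
Proof.
rewrite cat_uniq !map_inj_uniq ?ys_uniq 1?filter_uniq ?enum_uniq //;
  try by move=> ? ? [].
rewrite andbT; apply/hasPn => c /mapP[y _ ->]; by apply/mapP=> -[i _ []].
Qed.

Lemma gen_order i : gen (inl i) ^+ gamma i = 1.
Proof.
have -> : gen (inl i) ^+ gamma i = word_class _ (nseq (gamma i) (inl i, false)).
  rewrite word_class_prod; elim: (gamma i) => [|n IH]; first by rewrite big_nil.
  by rewrite big_cons -IH expgS.
apply: word_class_relator; rewrite mem_rcons inE; apply/orP; right.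
by apply/mapP; exists i; rewrite ?mem_enum.
Qed.

Lemma gen_expg_mod i n : gen (inl i) ^+ (n %% gamma i) = gen (inl i) ^+ n.
Proof.
by rewrite {2}(divn_eq n (gamma i)) expgnDr mulnC expgnA gen_order expg1n mul1g.
Qed.

(** Each [s_i] is a power of [s_i ^+ e i], so the long relator expresses
    [s_j] through [s_k] and the subgroup generated by the other entries. *)
Lemma powers_swap (e : 'I_l -> nat) (j k : 'I_l) : j != k ->
  (forall i, coprime (e i) (gamma i)) -> e k = 1%N ->
  exists2 t, perm_eq (map (powers e) (labels (predC1 j))) (powers e (inl k) :: t) /\
             perm_eq (map (powers e) (labels (predC1 k))) (powers e (inl j) :: t) &
             nielsen_equiv (powers e (inl k) :: t) (gen (inl j) :: t).
Proof.
move=> jk cop_e e_k.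
pose L0 := labels (fun i => (i != j) && (i != k)).
have inl_eq (i i' : 'I_l) : (inl i == inl i' :> 'I_l + Y) = (i == i') by [].
exists (map (powers e) L0).
  split; rewrite -map_cons; apply/perm_map/uniq_perm;
    rewrite ?labels_uniq //= ?labels_uniq ?mem_labels_inl ?eqxx ?andbF //; case=> [i|y].
  - rewrite inE !mem_labels_inl inl_eq /=.
    by case: (eqVneq i k) => [->|_]; rewrite ?andbT //= [k == j]eq_sym.
  - by rewrite inE !mem_labels_inr.
  - rewrite inE !mem_labels_inl inl_eq /=.
    by case: (eqVneq i j) => [->|].
  - by rewrite inE !mem_labels_inr.
set t := map _ L0.
have t_tail : absorbs t (word_class fuchsian_rels tail).
  rewrite word_class_prod -(big_map _ xpredT id); apply: absorbs_prod => x /mapP[a].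
  case/tail_ys => y y_ys ay ->.
  have : absorbs t (gen a.1).
    apply: absorbs_mem; apply/mapP; exists (inr y); first by rewrite mem_labels_inr.
    by rewrite ay.
  by case: a.2 => // /absorbsV.
have t_gen i : i != j -> i != k -> absorbs t (gen (inl i)).
  move=> ij ik.
  have e_gt0 : 0 < e i.
    rewrite lt0n; apply/eqP => e0; have := cop_e i; rewrite e0 /coprime gcd0n.
    by apply/negP; rewrite neq_ltn gamma_ge2 orbT.
  have [m n mn _] := egcdnP (gamma i) e_gt0.
  have -> : gen (inl i) = gen (inl i) ^+ e i ^+ m.
    rewrite -expgnA mulnC mn (eqP (cop_e i)) expgnDr mulnC expgnA gen_order.
    by rewrite expg1n mul1g expg1.
  apply: absorbsX; apply: absorbs_mem; apply/mapP; exists (inl i) => //.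
  by rewrite mem_labels_inl ij ik.
have t_gens (s : seq 'I_l) : j \notin s -> k \notin s ->
    absorbs t (\prod_(i <- s) gen (inl i)).
  move=> js ks; rewrite -(big_map _ xpredT id); apply: absorbs_prod => x /mapP[i i_s ->].
  by apply: t_gen; [move: js | move: ks]; apply: contraNneq => <-.
have split2 (c : 'I_l) s : uniq s -> c \in s -> exists s1 s2,
    [/\ s = s1 ++ c :: s2, c \notin s1 & c \notin s2].
  move=> s_uniq /splitPr def_s; case: def_s s_uniq => s1 s2.
  rewrite cat_uniq /= negb_or => /and3P[_ /andP[c1 _] /andP[c2 _]].
  by exists s1, s2.
have [e1 [e2 [enumE j1 j2]]] := split2 j (enum 'I_l) (enum_uniq _) (mem_enum _ _).
have := enum_uniq 'I_l; rewrite enumE cat_uniq /= => /and3P[e1_uniq e12 /andP[_ e2_uniq]].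
have relE : \prod_(i <- enum 'I_l) gen (inl i) * word_class fuchsian_rels tail = 1.
  have -> : \prod_(i <- enum 'I_l) gen (inl i) =
      word_class fuchsian_rels [seq (inl i, false) | i <- enum 'I_l].
    by rewrite word_class_prod [RHS]big_map.
  rewrite -word_class_cat; apply: word_class_relator; by rewrite mem_rcons mem_head.
rewrite enumE big_cat big_cons /= in relE.
have def_j : gen (inl j) = (\prod_(i <- e2) gen (inl i) *
    word_class fuchsian_rels tail * \prod_(i <- e1) gen (inl i))^-1.
  apply/esym/mulg1_eq; rewrite -mulgA.
  have <- : (\prod_(i <- e1) gen (inl i) * gen (inl j))^-1 =
      \prod_(i <- e2) gen (inl i) * word_class fuchsian_rels tail.
    by apply: mulg1_eq; rewrite -[RHS]relE !mulgA.
  exact: mulVg.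
have: k \in e1 ++ e2.
  have := mem_enum 'I_l k; rewrite enumE !mem_cat inE [k == j]eq_sym (negPf jk).
  by move=> ->.
rewrite mem_cat def_j /= e_k expg1 => /orP[] k_in.
- have [f1 [f2 [def_e1 k1 k2]]] := split2 k e1 e1_uniq k_in.
  have ke2 : k \notin e2.
    by apply: contra e12 => k_e2; rewrite /= (introT hasP) ?orbT //; exists k.
  move: j1; rewrite def_e1 mem_cat inE !negb_or => /and3P[j1 _ j1'].
  rewrite big_cat big_cons /= mulgA mulgA.
  by apply: nielsen_head_mulV; do ?apply: absorbsM; rewrite ?t_gens //; apply: t_gens.
- have [f1 [f2 [def_e2 k1 k2]]] := split2 k e2 e2_uniq k_in.
  have ke1 : k \notin e1.
    by apply: contra e12 => k_e1; rewrite /= (introT hasP) ?orbT //; exists k.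
  move: j2; rewrite def_e2 mem_cat inE !negb_or => /and3P[j2 _ j2'].
  rewrite big_cat big_cons /= -!mulgA mulgA.
  by apply: nielsen_head_mulV; do ?apply: absorbsM; rewrite ?t_gens //; apply: t_gens.
Qed.

Lemma powers_pm (a b : 'I_l -> nat) :
  (forall i, a i = b i %[mod gamma i] \/ gamma i %| a i + b i) ->
  forall c, powers b c = powers a c \/ powers b c = (powers a c)^-1.
Proof.
move=> ab [i|y] /=; last by left.
case: (ab i) => [a_b|ab0]; [left | right].
  by rewrite -gen_expg_mod -a_b gen_expg_mod.
by apply/esym/mulg1_eq; rewrite -expgnDr -gen_expg_mod (eqP ab0).
Qed.

Lemma powers_nielsen_equiv (a b : 'I_l -> nat) j k :
  (forall i, coprime (b i) (gamma i)) -> a j = 1%N -> b k = 1%N ->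
  (forall i, a i = b i %[mod gamma i] \/ gamma i %| a i + b i) ->
  nielsen_equiv (map (powers a) (labels (predC1 j)))
                (map (powers b) (labels (predC1 k))).
Proof.
move=> cop_b a_j b_k ab.
apply: (@nielsen_equiv_trans _ _ (map (powers b) (labels (predC1 j)))).
  by apply: nielsen_map_pm => c _; apply: powers_pm.
case: (eqVneq j k) => [->|jk]; first exact: rt_refl.
have [t [permj permk] swap] := powers_swap jk cop_b b_k.
apply: nielsen_equiv_trans (nielsen_equiv_perm permj) _.
rewrite perm_sym in permk; apply: nielsen_equiv_trans _ (nielsen_equiv_perm permk).
apply: (nielsen_equiv_trans swap) => {swap}.
have [] := powers_pm ab (inl j); rewrite /= a_j expg1 => ->; first exact: rt_refl.
exact: nielsen_inv_head.
Qed.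

Lemma size_labels j k : size (labels (predC1 j)) = size (labels (predC1 k)).
Proof.
case: (eqVneq j k) => [-> //|jk].
have [t [/perm_size + /perm_size +] _] :=
  @powers_swap (fun=> 1%N) j k jk (fun i => coprime1n _) erefl.
by rewrite /= !size_map => -> ->.
Qed.

End Families.

(** * Crossed homomorphisms of the group *)

Section AffineMonoid.
Local Open Scope ring_scope.
Variables (K : comUnitRingType) (n : nat).
Local Notation aff := ('M[K]_2 * 'M[K]_(2, n))%type.

(** The pair [(A, d)] stands for the affine map [y |-> A *m y + d]. *)
Definition aff_mul (x y : aff) : aff := (x.1 *m y.1, x.2 + x.1 *m y.2).
Definition aff_one : aff := (1%:M, 0).

Lemma aff_mulA : associative aff_mul.
Proof.
by move=> [A d] [B e] [C f]; rewrite /aff_mul /= mulmxA mulmxDr addrA mulmxA.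
Qed.

Lemma aff_mul1 : left_id aff_one aff_mul.
Proof. by move=> [A d]; rewrite /aff_mul /= !mul1mx add0r. Qed.

Lemma aff_mulr1 : right_id aff_one aff_mul.
Proof. by move=> [A d]; rewrite /aff_mul /= mulmx1 mulmx0 addr0. Qed.

HB.instance Definition _ := Monoid.isLaw.Build aff aff_one aff_mul
  aff_mulA aff_mul1 aff_mulr1.

(** An affine map with a fixed point [y] is conjugate to its linear part. *)
Lemma aff_prod_nseq (T : Type) (c : T) (f : T -> aff) A y m :
  f c = (A, (1 - A) *m y) ->
  \big[aff_mul/aff_one]_(a <- nseq m c) f a = (A ^+ m, (1 - A ^+ m) *m y).
Proof.
move=> fc; elim: m => [|m IH]; first by rewrite big_nil expr0 subrr mul0mx.
rewrite big_cons IH fc /aff_mul /= exprS mulmxA -mulmxDl; congr (_, _ *m _).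
by rewrite mulmxE mulrBr mulr1 addrA subrK.
Qed.

Lemma aff_prod_fst (T : Type) (s : seq T) (f : T -> aff) :
  (\big[aff_mul/aff_one]_(a <- s) f a).1 = \prod_(a <- s) (f a).1.
Proof. by elim: s => [|c s IH]; rewrite ?big_nil // !big_cons -IH. Qed.

End AffineMonoid.

Section CrossedExtension.
Local Open Scope ring_scope.
Variables (X : choiceType) (R : seq (word X)) (K : comUnitRingType) (n : nat).
Variables (A : X -> 'M[K]_2) (d : X -> 'M[K]_(2, n)).

Definition aff_letter (a : X * bool) : 'M[K]_2 * 'M[K]_(2, n) :=
  if a.2 then ((A a.1)^-1, - ((A a.1)^-1 *m d a.1)) else (A a.1, d a.1).

Hypothesis det_A : forall x, \det (A x) = 1.
Hypothesis aff_R : forall r, r \in R ->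
  \big[@aff_mul K n/aff_one K n]_(a <- r) aff_letter a = aff_one K n.

Lemma crossed_hom_exists : exists rho delta,
  [/\ forall x : pgroup R, \det (rho x) = 1,
      rho 1%g = 1%:M :> 'M[K]_2,
      forall x y : pgroup R, rho (x * y)%g = rho x *m rho y,
      forall x y : pgroup R, delta (x * y)%g = delta x + rho x *m delta y &
      forall x, rho (gen R x) = A x /\ delta (gen R x) = d x].
Proof.
have A_unit x : A x \is a GRing.unit by rewrite unitmxE det_A unitr1.
have letterV x e :
    aff_mul (aff_letter (x, e)) (aff_letter (x, ~~ e)) = aff_one K n.
  case: e; rewrite /aff_mul /aff_letter /= ?mulmxE ?mulVr ?mulrV //.
    by rewrite addNr.
  by rewrite mulmxN mulmxA mulmxE mulrV // mul1mx subrr.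
pose phi := @presented_eval X R _ _ (@aff_mul K n) aff_letter.
have phiM x y : phi (x * y)%g = aff_mul (phi x) (phi y).
  exact: presented_evalM.
have phi_gen x : phi (gen R x) = (A x, d x) by exact: presented_eval_gen.
exists (fun x => (phi x).1), (fun x => (phi x).2); split=> [x||x y|x y|x].
- rewrite aff_prod_fst; elim: (prepr x) => [|a w IH]; first by rewrite big_nil det1.
  rewrite big_cons -mulmxE det_mulmx IH mulr1 /aff_letter; case: a.2 => //=.
  by rewrite det_inv det_A invr1.
- rewrite -[1%g]/(word_class R [::]) /phi presented_eval_class //.
  by rewrite big_nil.
- by rewrite phiM.
- by rewrite phiM.
- by rewrite phi_gen.
Qed.

End CrossedExtension.

Section FuchsianCrossedHom.
Local Open Scope ring_scope.
Variables (l : nat) (gamma : 'I_l -> nat) (Y : choiceType).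
Variables (tail : word ('I_l + Y)%type) (ys : seq Y).
Hypothesis tail_ys : forall a, a \in tail -> exists2 y, y \in ys & a.1 = inr y.
Hypothesis ys_uniq : uniq ys.
Variables (K : fieldType) (A : 'I_l -> 'M[K]_2) (j : 'I_l).
Hypothesis det_A : forall i, \det (A i) = 1.
Hypothesis A_order : forall i, A i ^+ gamma i = 1.
Hypothesis A_fix : forall i, \det (1 - A i) != 0.
Hypothesis A_prod : \prod_(i <- enum 'I_l) A i = 1.

Local Notation G := (pgroup (fuchsian_rels gamma tail)).
Local Notation L := (labels ys (predC1 j)).
Local Notation N := (size L).

(** On the generators other than [s_j] a crossed homomorphism can be
    prescribed at will, and the long relator then dictates its value at [s_j].
    The torsion relators impose nothing: as [1 - A i] is invertible, the affine
    map attached to [s_i] has a fixed point, hence the order of [A i]. *)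
Lemma fuchsian_crossed_hom_exists :
  exists (rho : G -> 'M[K]_2) (delta : G -> 'M[K]_(2, N * 2)),
  [/\ forall x, \det (rho x) = 1,
      rho 1%g = 1%:M :> 'M[K]_2,
      forall x y, rho (x * y)%g = rho x *m rho y,
      forall x y, delta (x * y)%g = delta x + rho x *m delta y &
      (forall i, rho (gen _ (inl i)) = A i) /\
      (forall r : 'I_N, delta (gen _ (nth (inl j) L r)) = block_proj K r)].
Proof.
pose AX (c : 'I_l + Y) := if c is inl i then A i else 1.
pose d0 (c : 'I_l + Y) : 'M[K]_(2, N * 2) :=
  oapp (fun r : 'I_N => block_proj K r) 0 (insub (index c L)).
pose ev0 w := \big[@aff_mul K (N * 2)/aff_one K (N * 2)]_(a <- w) aff_letter AX d0 a.
have [e1 [e2 enumE]] : exists e1 e2, enum 'I_l = e1 ++ j :: e2.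
  by case/splitPr: (mem_enum 'I_l j : j \in enum 'I_l) => e1 e2; exists e1, e2.
have := enum_uniq 'I_l; rewrite enumE cat_uniq /= negb_or.
case/and3P=> _ /andP[j1 _] /andP[j2 _].
pose lett (i : 'I_l) : ('I_l + Y) * bool := (inl i, false).
pose P := ev0 (map lett e1); pose Q := ev0 (map lett e2 ++ tail).
(* The value at [s_j] that makes the translation part of the long relator
   [P s_j Q] vanish. *)
pose dj := - (P.1^-1 *m P.2) - A j *m Q.2.
pose d c := if c == inl j then dj else d0 c.
have det_AX c : \det (AX c) = 1 by case: c => [i|y] /=; rewrite ?det_A ?det1.
have evE w : all (fun a => a.1 != inl j) w ->
    \big[@aff_mul K (N * 2)/aff_one K (N * 2)]_(a <- w) aff_letter AX d a = ev0 w.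
  move=> /allP wj; apply: eq_big_seq => a /wj aj.
  by rewrite /aff_letter /d (negPf aj).
have lettj e : j \notin e -> all (fun a => a.1 != inl j) (map lett e).
  move=> je; apply/allP=> a /mapP[i i_e ->] /=.
  by apply: contraNneq je => -[<-].
have tailj : all (fun a : ('I_l + Y) * bool => a.1 != inl j) tail.
  by apply/allP=> a /tail_ys[y _ ->].
have rels_ev r : r \in fuchsian_rels gamma tail ->
    \big[@aff_mul K (N * 2)/aff_one K (N * 2)]_(a <- r) aff_letter AX d a =
    aff_one K (N * 2).
  rewrite mem_rcons inE => /orP[/eqP->|/mapP[i _ ->]]; last first.
    have Ai_unit : 1 - A i \is a GRing.unit by rewrite unitmxE unitfE.
    rewrite (@aff_prod_nseq K _ _ _ _ (A i) ((1 - A i)^-1 *m d (inl i))).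
      by rewrite A_order subrr mul0mx.
    by rewrite /aff_letter /= mulmxA mulmxE mulrV // mul1mx.
  apply: injective_projections.
    rewrite aff_prod_fst big_cat big_map /= A_prod mul1r big1_seq //.
    move=> a /tail_ys[y _]; rewrite /aff_letter /= => ->.
    by case: ifP => //=; rewrite invr1.
  rewrite -/lett enumE map_cat -catA big_cat map_cons cat_cons big_cons /=.
  rewrite !evE ?all_cat ?lettj // -/P -/Q /aff_letter /= /d eqxx /dj.
  rewrite subrK mulmxN mulmxA mulmxE mulrV ?mul1mx ?subrr //.
  rewrite unitmxE aff_prod_fst big_map.
  elim: e1 {enumE j1 P dj d evE} => [|i e IH].
    by rewrite big_nil det1 unitr1.
  by rewrite big_cons -mulmxE det_mulmx det_A mul1r.
have [rho [delta [dr r1 rM dM gens]]] := crossed_hom_exists det_AX rels_ev.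
exists rho, delta; split=> //; split=> [i|r]; first by case: (gens (inl i)).
case: (gens (nth (inl j) L r)) => _ ->.
have r_in : nth (inl j) L r \in L by apply: mem_nth.
rewrite /d ifN; last first.
  by apply: contraL r_in => /eqP->; rewrite mem_labels_inl /= eqxx.
by rewrite /d0 index_uniq ?labels_uniq // valK.
Qed.

End FuchsianCrossedHom.

(** * The torsion of a family of powers *)

Section Torsion.
Local Open Scope ring_scope.
Variables (l : nat) (gamma : 'I_l -> nat) (Y : choiceType).
Variables (tail : word ('I_l + Y)%type) (ys : seq Y).
Hypothesis gamma_ge2 : forall i, (2 <= gamma i)%N.
Hypothesis tail_ys : forall a, a \in tail -> exists2 y, y \in ys & a.1 = inr y.
Hypothesis ys_uniq : uniq ys.
Variables (K : fieldType) (A : 'I_l -> 'M[K]_2).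
Hypothesis det_A : forall i, \det (A i) = 1.
Hypothesis A_order : forall i, A i ^+ gamma i = 1.
Hypothesis A_fix : forall i, \det (1 - A i) != 0.
Hypothesis A_prod : \prod_(i <- enum 'I_l) A i = 1.

Local Notation powers := (powers gamma tail).
Local Notation labels j := (labels ys (predC1 j)).

(** Fox calculus for a power: [d(x^n) = (1 - x^n) / (1 - x) dx]. *)
Lemma crossed_expg (G : groupType) m (rho : G -> 'M[K]_2) (delta : G -> 'M[K]_(2, m))
    (x : G) n :
  rho 1%g = 1%:M -> delta 1%g = 0 ->
  (forall x y, rho (x * y)%g = rho x *m rho y) ->
  (forall x y, delta (x * y)%g = delta x + rho x *m delta y) ->
  \det (1 - rho x) != 0 ->
  delta (x ^+ n)%g = ((1 - rho x ^+ n) / (1 - rho x)) *m delta x.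
Proof.
move=> rho1 delta1 rhoM deltaM fix_x.
have x_unit : 1 - rho x \is a GRing.unit by rewrite unitmxE unitfE.
elim: n => [|n IH]; first by rewrite expg0 expr0 delta1 subrr mul0r mul0mx.
rewrite expgS deltaM IH mulmxA -[X in X + _]mul1mx -mulmxDl; congr (_ *m _).
have -> : 1%:M = (1 - rho x) / (1 - rho x) by rewrite divrr.
by rewrite mulmxE mulrA -mulrDl mulrBr mulr1 -exprS addrA subrK.
Qed.

(** By the previous lemma the family [powers e] arises from the generators by
    a block-diagonal matrix, so its volume is the product of the ratios
    [\det (1 - A i ^+ e i) / \det (1 - A i)]; the index [j] left out
    contributes the trivial factor because [e j = 1]. *)
Lemma torsion_invariant (a b : 'I_l -> nat) j k :
  a j = 1%N -> b k = 1%N ->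
  nielsen_equiv (map (powers a) (labels j)) (map (powers b) (labels k)) ->
  (\prod_(i <- enum 'I_l) \det (1 - A i ^+ a i)) ^+ 2 =
  (\prod_(i <- enum 'I_l) \det (1 - A i ^+ b i)) ^+ 2.
Proof.
move=> a_j b_k ab.
have [rho [delta [dr r1 rM dM [rho_s delta_gen]]]] :=
  fuchsian_crossed_hom_exists tail_ys ys_uniq j det_A A_order A_fix A_prod.
pose vol t := \det (crossed_mx delta t) ^+ 2.
have vol_nielsen t t' : size t = size (labels j) -> nielsen_equiv t t' -> vol t' = vol t.
  by move=> tN; apply: (crossed_volume_nielsen dr dM r1 tN).
have powers1 : powers (fun=> 1%N) =1 gen (fuchsian_rels gamma tail).
  by case=> [i|y] //=; rewrite expg1.
have vol_gens i : vol (map (gen _) (labels i)) = 1.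
  have <- : vol (map (gen _) (labels j)) = 1.
    rewrite /vol; suff -> : crossed_mx delta (map (gen _) (labels j)) = 1%:M.
      by rewrite det1 expr1n.
    rewrite -block_sum1; apply: eq_bigr => r _.
    by rewrite (nth_map (inl j)) ?delta_gen.
  rewrite -!(eq_map powers1); apply: vol_nielsen; first by rewrite size_map.
  apply: (powers_nielsen_equiv gamma_ge2 tail_ys ys_uniq) => // i'; last by left.
  exact: coprime1n.
pose C (e : 'I_l -> nat) (c : 'I_l + Y) :=
  if c is inl i then (1 - A i ^+ e i) / (1 - A i) else 1.
have vol_powers e i : e i = 1%N -> vol (map (powers e) (labels i)) =
    ((\prod_(i <- enum 'I_l) \det (1 - A i ^+ e i)) /
     (\prod_(i <- enum 'I_l) \det (1 - A i))) ^+ 2.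
  move=> e_i; rewrite /vol (@crossed_volume_scale _ _ _ _ _ (inl j) _ (gen _) _ (C e)).
  - rewrite exprMn [X in _ * X]vol_gens mulr1; congr (_ ^+ 2).
    rewrite big_cat [X in X * _ = _]big_map [X in _ * X = _]big_map /= big_filter.
    rewrite [X in _ * X = _]big1 ?mulr1 => [|y _]; last exact: det1.
    rewrite big_mkcond -prodf_div; apply: eq_bigr => i' _ /=.
    case: (eqVneq i' i) => [->|_] /=; first by rewrite e_i expr1 divff.
    by rewrite -mulmxE det_mulmx det_inv.
  - exact: (size_labels gamma_ge2 tail_ys ys_uniq).
  - case=> [i'|y] /=; last by rewrite mul1mx.
    rewrite -rho_s; apply: crossed_expg => //; last by rewrite rho_s.
    exact: (delta1 dM r1).
have := vol_nielsen _ _ _ ab; rewrite size_map => /(_ erefl).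
rewrite !vol_powers // !exprMn => /mulIf-> //.
rewrite expf_neq0 // invr_neq0 // prodf_seq_neq0.
by apply/allP=> i _ /=; apply: A_fix.
Qed.

End Torsion.

(** * Rigidity of the torsion *)

Section Chords.
Local Open Scope ring_scope.
Implicit Types (w : algC) (n : nat).

(** For [w] on the unit circle, the squared distance between [1] and [w]. *)
Definition chord w := (1 - w) * (1 - w^-1).

Lemma chord_norm w : `|w| = 1 -> chord w = `|1 - w| ^+ 2.
Proof.
move=> w1; rewrite normCK rmorphB rmorph1 /=.
by rewrite /chord invC_norm w1 expr1n invr1 mul1r.
Qed.

Lemma chord_inj w w' : w != 0 -> w' != 0 -> chord w = chord w' ->
  w = w' \/ w * w' = 1.
Proof.
move=> w0 w'0 ww'.
have /eqP : (w - w') * (w * w' - 1) = 0.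
  have -> : (w - w') * (w * w' - 1) = (chord w' - chord w) * (w * w').
    by rewrite /chord; field; apply/andP.
  by rewrite ww' subrr mul0r.
by rewrite mulf_eq0 !subr_eq0 => /orP[] /eqP; [left | right].
Qed.

Lemma prod_1B_prim_root n w w' :
  n.-primitive_root w -> n.-primitive_root w' ->
  \prod_(1 <= i < n) (1 - w ^+ i) = \prod_(1 <= i < n) (1 - w' ^+ i).
Proof.
move=> w_n w'_n; have n0 := prim_order_gt0 w_n.
have : \prod_(1 <= i < n) ('X - (w ^+ i)%:P) = \prod_(1 <= i < n) ('X - (w' ^+ i)%:P).
  (* Both sides become ['X^n - 1] once multiplied by the missing factor. *)
  apply: (@mulfI _ ('X - (1 : algC)%:P)); first by rewrite polyXsubC_eq0.
  have := factor_Xn_sub_1 w'_n; rewrite -(factor_Xn_sub_1 w_n).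
  by rewrite !(big_ltn n0) !expr0.
move/(congr1 (horner^~ 1)); rewrite !horner_prod.
by under eq_bigr do rewrite hornerXsubC; under [RHS]eq_bigr do rewrite hornerXsubC.
Qed.

Lemma norm_prim_root n w k : n.-primitive_root w -> `|w ^+ k| = 1.
Proof.
move=> w_n; rewrite normrX.
have n0 := prim_order_gt0 w_n.
have /eqP : `|w| ^+ n = 1 by rewrite -normrX (prim_expr_order w_n) normr1.
by rewrite pexpr_eq1 // => /eqP->; rewrite expr1n.
Qed.

(** Raising a primitive [n]-th root of unity to the power [a] permutes the
    nontrivial [n]-th roots of unity. *)
Lemma chord_prod n w a : n.-primitive_root w -> coprime a n ->
  \prod_(1 <= k < n) chord (w ^+ k ^+ a) =
  `|\prod_(1 <= k < n) (1 - w ^+ k)| ^+ 2.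
Proof.
move=> w_n a_n.
have wa_n : n.-primitive_root (w ^+ a) by rewrite prim_root_exp_coprime.
rewrite (prod_1B_prim_root w_n wa_n) normr_prod -prodrXl; apply: eq_bigr => k _.
rewrite chord_norm -!exprM; last exact: norm_prim_root w_n.
by rewrite mulnC.
Qed.

Lemma chord_gt0 n w k a : n.-primitive_root w -> coprime a n -> ~~ (n %| k)%N ->
  0 < chord (w ^+ k ^+ a).
Proof.
move=> w_n a_n nk; rewrite -exprM chord_norm; last exact: norm_prim_root w_n.
rewrite exprn_gt0 // normr_gt0 subr_eq0 eq_sym -(prim_order_dvd w_n).
by rewrite Gauss_dvdl // coprime_sym.
Qed.

(** If the chords at [w ^ (k a)] and [w ^ (k b)] are proportional for all [k],
    then the factor of proportionality is 1, since both have the same product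
    over [k]. *)
Lemma chord_rigidity n w a b (c c' : algC) :
  (1 < n)%N -> n.-primitive_root w -> coprime a n -> coprime b n ->
  0 < c -> 0 < c' ->
  (forall k, (0 < k < n)%N ->
    chord (w ^+ k ^+ a) ^+ 2 * c = chord (w ^+ k ^+ b) ^+ 2 * c') ->
  a = b %[mod n] \/ (n %| a + b)%N.
Proof.
move=> n_gt1 w_n a_n b_n c0 c'0 prop_ab.
have prod0 : \prod_(1 <= k < n) chord (w ^+ k ^+ b) != 0.
  rewrite prodf_seq_neq0; apply/allP=> k; rewrite mem_index_iota => /andP[k0 kn] /=.
  by rewrite gt_eqF // (chord_gt0 w_n) // gtnNdvd.
have cc' : c = c'.
  have : \prod_(1 <= k < n) (chord (w ^+ k ^+ a) ^+ 2 * c) =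
         \prod_(1 <= k < n) (chord (w ^+ k ^+ b) ^+ 2 * c').
    by apply: eq_big_nat => k /prop_ab.
  rewrite [LHS]big_split [RHS]big_split /= !prodrXl !prodr_const_nat.
  rewrite (chord_prod w_n a_n) -(chord_prod w_n b_n) => /mulfI cc'.
  have /eqP := cc' (expf_neq0 2 prod0).
  by rewrite eqrXn2 ?ltW ?subn_gt0 // => /eqP.
have := prop_ab 1%N; rewrite n_gt1 cc' => /(_ isT) /mulIf.
rewrite gt_eqF // => /(_ isT) /eqP.
have n1 : ~~ (n %| 1)%N by rewrite gtnNdvd.
rewrite eqrXn2 ?ltW ?(chord_gt0 w_n) // => /eqP; rewrite expr1.
have w_neq0 m : w ^+ m != 0 by rewrite -normr_gt0 (norm_prim_root m w_n) ltr01.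
case/chord_inj => // [/eqP|/eqP].
  by rewrite (eq_prim_root_expr w_n) => /eqP; left.
by rewrite -exprD -(prim_order_dvd w_n); right.
Qed.

End Chords.

Section Rigidity.
Local Open Scope ring_scope.
Variables (l : nat) (gamma : 'I_l -> nat) (Y : choiceType).
Variables (tail : word ('I_l + Y)%type) (ys : seq Y).
Hypothesis gamma_ge2 : forall i, (2 <= gamma i)%N.
Hypothesis tail_ys : forall a, a \in tail -> exists2 y, y \in ys & a.1 = inr y.
Hypothesis ys_uniq : uniq ys.

Lemma exists_three_other (i0 : 'I_l) : (3 < num_ge3 gamma)%N -> exists p q r,
  [/\ [/\ p != i0, q != i0 & r != i0], [/\ p != q, p != r & q != r] &
      {in [:: p; q; r], forall i, 2 < gamma i}%N].
Proof.
rewrite /num_ge3 (cardsD1 i0) => many.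
have /card_gt2P[p [q [r [[pS qS rS] [pq qr rp]]]]] :
    (2 < #|[set i | 2 < gamma i] :\ i0|)%N.
  by rewrite -ltnS; apply: leq_trans many _; case: (_ \in _).
move: pS qS rS; rewrite !inE => /andP[p0 gp] /andP[q0 gq] /andP[r0 gr].
exists p, q, r; split=> //; first by split; rewrite // eq_sym.
by move=> i; rewrite !inE => /or3P[] /eqP->.
Qed.

Lemma mx2_diag_exp (K : fieldType) (x : K) n :
  mx2 x 0 0 x^-1 ^+ n = mx2 (x ^+ n) 0 0 (x ^- n).
Proof.
elim: n => [|n IH]; first by rewrite !expr0 invr1 mx2_1.
by rewrite exprS IH mulmx2 !mul0r !mulr0 !addr0 add0r -!exprVn !exprS.
Qed.

Lemma powers_rigidity (a b : 'I_l -> nat) j k :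
  (3 < num_ge3 gamma)%N ->
  (forall i, coprime (a i) (gamma i)) -> (forall i, coprime (b i) (gamma i)) ->
  a j = 1%N -> b k = 1%N ->
  nielsen_equiv (map (powers gamma tail a) (labels ys (predC1 j)))
                (map (powers gamma tail b) (labels ys (predC1 k))) ->
  forall i, a i = b i %[mod gamma i] \/ (gamma i %| a i + b i)%N.
Proof.
move=> many cop_a cop_b a_j b_k ab i0.
have [w w_prim] : exists w : 'I_l -> algC, forall i, (gamma i).-primitive_root (w i).
  apply: (@fin_all_exists _ (fun=> algC) (fun i x => (gamma i).-primitive_root x)) => i.
  by have [x] := C_prim_root_exists (ltnW (gamma_ge2 i)); exists x.
have [p [q [r [[p0 q0 r0] [pq pr qr] big_gamma]]]] := exists_three_other i0 many.
(* The exponent 1 leaves the eigenvalue [w i] unchanged at the indices other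
   than [i0]. *)
pose rest (e : 'I_l -> nat) := \prod_(i | i != i0) chord (w i ^+ 1 ^+ e i).
have rest_gt0 e : (forall i, coprime (e i) (gamma i)) -> 0 < rest e ^+ 2.
  move=> cop_e; rewrite exprn_gt0 // prodr_gt0 // => i _.
  by apply: (chord_gt0 (w_prim i)); rewrite // gtnNdvd.
apply: (chord_rigidity (gamma_ge2 i0) (w_prim i0) (cop_a i0) (cop_b i0)
          (rest_gt0 a cop_a) (rest_gt0 b cop_b)) => m /andP[m0 m_lt].
pose z i := w i ^+ (if i == i0 then m else 1).
have nd i : ~~ (gamma i %| if i == i0 then m else 1)%N.
  by case: eqP => [->|_]; rewrite gtnNdvd.
have z0 i : z i != 0 by rewrite -normr_gt0 (norm_prim_root _ (w_prim i)) ltr01.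
have z1 i : z i != 1 by rewrite -(prim_order_dvd (w_prim i)).
have z_order i : z i ^+ gamma i = 1.
  by rewrite -exprM mulnC exprM (prim_expr_order (w_prim i)) expr1n.
have [A [A_spec A_diag A_prod]] := @exists_spectral_product algC _ (enum 'I_l) z p q r
  (enum_uniq _) (mem_enum _ _) (mem_enum _ _) (mem_enum _ _) pq pr qr z0.
have detA n i : \det (1 - A i ^+ n) = chord (z i ^+ n).
  exact: (spectral_det1BX n (z0 i) (A_spec i)).
have A_order i : A i ^+ gamma i = 1.
  case: (boolP (i \in [:: p; q; r])) => [i_pqr|/A_diag->]; last first.
    by rewrite mx2_diag_exp z_order invr1 mx2_1.
  have i_i0 : i != i0 by move: i_pqr; rewrite !inE => /or3P[] /eqP->.
  apply: (spectral_expr1 (z0 i) _ (A_spec i) (z_order i)).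
  rewrite /z (negPf i_i0) expr1 -(prim_order_dvd (w_prim i)).
  by rewrite gtnNdvd ?big_gamma.
have A_fix i : \det (1 - A i) != 0.
  rewrite -[A i]expr1 detA expr1 -[z i]expr1 gt_eqF //.
  by rewrite (chord_gt0 (w_prim i)) // coprime1n.
have := torsion_invariant gamma_ge2 tail_ys ys_uniq (fun i => (A_spec i).1)
          A_order A_fix A_prod a_j b_k ab.
have splitE e : \prod_(i <- enum 'I_l) \det (1 - A i ^+ e i) =
    chord (w i0 ^+ m ^+ e i0) * rest e.
  rewrite big_enum (bigD1 i0) //= detA /z eqxx; congr (_ * _).
  by apply: eq_bigr => i i_i0; rewrite detA /z (negPf i_i0).
by rewrite !splitE !exprMn.
Qed.

Lemma powers_nielsen_equivP (a b : 'I_l -> nat) j k :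
  (3 < num_ge3 gamma)%N ->
  (forall i, coprime (a i) (gamma i)) -> (forall i, coprime (b i) (gamma i)) ->
  a j = 1%N -> b k = 1%N ->
  nielsen_equiv (map (powers gamma tail a) (labels ys (predC1 j)))
                (map (powers gamma tail b) (labels ys (predC1 k))) <->
  forall i, a i = b i %[mod gamma i] \/ (gamma i %| a i + b i)%N.
Proof.
move=> many cop_a cop_b a_j b_k; split; first exact: powers_rigidity.
exact: (powers_nielsen_equiv gamma_ge2 tail_ys ys_uniq).
Qed.

End Rigidity.

(** * Integer exponents and the two presentations *)

Section Residues.
Local Open Scope ring_scope.

Definition residue (d : nat) (z : int) : nat := `|(z %% d)%Z|%N.

Lemma residueE d z : (0 < d)%N -> (residue d z)%:Z = (z %% d)%Z.
Proof. by move=> d0; rewrite gez0_abs // modz_ge0 // -lt0n. Qed.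

Lemma coprime_residue d z : (0 < d)%N -> coprimez z d -> coprime (residue d z) d.
Proof. by move=> d0; rewrite /coprimez -gcdz_modl -residueE. Qed.

Lemma residue1 d : (1 < d)%N -> residue d 1 = 1%N.
Proof. by move=> d1; rewrite /residue modz_small. Qed.

Lemma residue_congr_pm d (y z : int) : (0 < d)%N ->
  (residue d y = residue d z %[mod d] \/ d %| residue d y + residue d z)%N <->
  ((y = z %[mod d])%Z \/ (y = - z %[mod d])%Z).
Proof.
move=> d0.
have eqE : (residue d y = residue d z %[mod d])%N <-> (y = z %[mod d])%Z.
  split=> [/(congr1 Posz)|yz]; last by rewrite /residue yz.
  by rewrite -!modz_nat !residueE // !modz_mod.
have oppE : (d %| residue d y + residue d z)%N <-> (y = - z %[mod d])%Z.
  have -> : (d %| residue d y + residue d z)%N = (d %| y + z)%Z.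
    rewrite -[LHS]/(d %| (residue d y + residue d z)%N%:Z)%Z PoszD !residueE //.
    by apply/dvdz_mod0P/dvdz_mod0P; rewrite modzDm.
  rewrite -[z in (y + z)]opprK -eqz_mod_dvd; by split=> /eqP.
by rewrite eqE oppE.
Qed.

Lemma zexpg_residue (G : groupType) (x : G) d (z : int) :
  (0 < d)%N -> (x ^+ d = 1)%g -> zexpg x z = (x ^+ residue d z)%g.
Proof.
move=> d0 xd.
have xM n : (d %| n)%N -> (x ^+ n = 1)%g.
  by case/dvdnP=> q ->; rewrite mulnC expgnA xd expg1n.
case: z => n /=.
  rewrite /residue modz_nat absz_nat {1}(divn_eq n d) expgnDr.
  by rewrite (xM (n %/ d * d)%N) ?dvdn_mull // mul1g.
apply/mulg1_eq; rewrite -expgnDr xM //.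
rewrite -[(_ %| _)%N]/(d %| (n.+1 + residue d (Negz n))%N%:Z)%Z PoszD residueE //.
by rewrite addrC -[X in _ + X]opprK -NegzE -eqz_mod_dvd modz_mod.
Qed.

End Residues.

Section MainCases.
Variables (l : nat) (gamma : 'I_l -> nat).
Hypothesis gamma_ge2 : forall i : 'I_l, 2 <= gamma i.
Variables (j k : 'I_l) (u v : 'I_l -> int).
Hypothesis cop_u : forall i : 'I_l, i != j -> coprimez (u i) (gamma i).
Hypothesis cop_v : forall i : 'I_l, i != k -> coprimez (v i) (gamma i).
Hypotheses (u_j : u j = 1%Z) (v_k : v k = 1%Z).
Variables (Y : choiceType) (tail : word ('I_l + Y)%type) (ys : seq Y).
Hypothesis tail_ys : forall a, a \in tail -> exists2 y, y \in ys & a.1 = inr y.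
Hypothesis ys_uniq : uniq ys.
Hypothesis many : 3 < num_ge3 gamma.

Let R := fuchsian_rels gamma tail.

Definition torsion_and_free (e : 'I_l -> int) (i : 'I_l) : seq (pgroup R) :=
  torsion_family (fun i => gen R (inl i)) e i ++ [seq gen R (inr y) | y <- ys].

Lemma torsion_and_free_powers e i : torsion_and_free e i =
  map (powers gamma tail (fun i => residue (gamma i) (e i))) (labels ys (predC1 i)).
Proof.
rewrite map_cat -!map_comp; congr (_ ++ _); apply: eq_map => i' /=.
by apply: zexpg_residue; [apply: ltnW | apply: gen_order].
Qed.

Lemma torsion_and_free_nielsen_equivP :
  nielsen_equiv (torsion_and_free u j) (torsion_and_free v k) <-> congr_pm gamma u v.
Proof.
have g0 i : 0 < gamma i by apply: ltnW.
have cop (e : 'I_l -> int) i0 : (forall i, i != i0 -> coprimez (e i) (gamma i)) ->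
    e i0 = 1%Z -> forall i, coprime (residue (gamma i) (e i)) (gamma i).
  move=> cop_e e1 i; case: (eqVneq i i0) => [->|/cop_e]; last exact: coprime_residue.
  by rewrite e1 residue1 // coprime1n.
rewrite !torsion_and_free_powers powers_nielsen_equivP //; first last.
- by rewrite v_k residue1.
- by rewrite u_j residue1.
- exact: cop cop_v v_k.
- exact: cop cop_u u_j.
by split=> uv i; apply/residue_congr_pm.
Qed.

End MainCases.

Theorem corollary8p1 (l : nat) (gamma : 'I_l -> nat)
    (gamma_ge2 : forall i : 'I_l, 2 <= gamma i)
    (j k : 'I_l) (u v : 'I_l -> int)
    (cop_u : forall i : 'I_l, i != j -> coprimez (u i) (gamma i))
    (cop_v : forall i : 'I_l, i != k -> coprimez (v i) (gamma i))
    (u_j : u j = 1%Z) (v_k : v k = 1%Z) :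
  (forall g : nat,
     1 <= l -> 1 <= g ->
     (~~ odd (num_eq2 gamma) -> 5 <= num_ge3 gamma) ->
     (odd (num_eq2 gamma) -> 7 <= num_ge3 gamma) ->
     nielsen_equiv (ofamily gamma g u j) (ofamily gamma g v k)
       <-> congr_pm gamma u v)
  /\
  (forall h : nat,
     (1 <= l /\ 2 <= h) \/ (2 <= l /\ 1 <= h) ->
     (~~ odd (num_eq2 gamma + h) -> 5 <= num_ge3 gamma) ->
     (odd (num_eq2 gamma + h) -> 7 <= num_ge3 gamma) ->
     nielsen_equiv (nfamily gamma h u j) (nfamily gamma h v k)
       <-> congr_pm gamma u v).
Proof.
have many n : (~~ odd n -> 5 <= num_ge3 gamma) -> (odd n -> 7 <= num_ge3 gamma) ->
    3 < num_ge3 gamma.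
  by move=> even_n odd_n; case: (boolP (odd n)) => [/odd_n|/even_n]; apply: leq_trans.
split=> [g _ _ /many h /h{h} m4|h _ /many h' /h'{h'} m4].
- pose ys : seq ('I_g + 'I_g) := flatten [seq [:: inl i; inr i] | i <- enum 'I_g].
  have ys_mem y : y \in ys.
    by case: y => i; apply/flatten_mapP; exists i; rewrite ?mem_enum ?inE ?eqxx ?orbT.
  have ys_uniq : uniq ys.
    have ys_size : size ys = #|{: 'I_g + 'I_g}|.
      rewrite size_flatten /shape -map_comp card_sum card_ord.
      rewrite (eq_map (_ : _ =1 fun=> 2)) // sumnE big_map big_enum.
      by rewrite sum_nat_const card_ord muln2 addnn.
    by apply/card_uniqP; rewrite ys_size; apply: eq_card => y; rewrite ys_mem.
  pose tail : word (ogen l g) :=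
    flatten [seq [:: (inr (inl i), false); (inr (inr i), false);
                     (inr (inl i), true); (inr (inr i), true)] | i <- enum 'I_g].
  have tail_ys a : a \in tail -> exists2 y, y \in ys & a.1 = inr y.
    move=> /flatten_mapP[i _]; rewrite !inE.
    by case/or4P=> /eqP->; eexists; try apply: ys_mem.
  have := torsion_and_free_nielsen_equivP gamma_ge2 cop_u cop_v u_j v_k
    tail_ys ys_uniq m4.
  by rewrite /torsion_and_free map_flatten -map_comp.
- pose tail : word (ngen l h) :=
    flatten [seq [:: (inr i, false); (inr i, false)] | i <- enum 'I_h].
  have tail_ys a : a \in tail -> exists2 y, y \in enum 'I_h & a.1 = inr y.
    move=> /flatten_mapP[i _]; rewrite !inE.
    by case/orP=> /eqP->; exists i; rewrite ?mem_enum.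
  exact: (torsion_and_free_nielsen_equivP gamma_ge2 cop_u cop_v u_j v_k
    tail_ys (enum_uniq _) m4).
Qed.
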